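(* Let $\mathcal{T}=\mathrm{PT2D}(A,B,F,G,H)\in\mathbb{R}^{I\times J\times K}$ with $A\in\mathbb{R}^{I\times R}$, $B\in\mathbb{R}^{J\times S}$, $F\in\mathbb{R}^{R\times S}$, $G\in\mathbb{R}^{R\times K}$, $H\in\mathbb{R}^{S\times K}$, and assume that (i) $\operatorname{rank}A=R$ and $\operatorname{rank}B=S$; (ii) $F$ has no zero entries; (iii) $\operatorname{rank}(G\odot G\odot H\odot H)=\frac{R(R+1)}{2}\cdot\frac{S(S+1)}{2}$; (iv) $\operatorname{krank}(F)\ge2$ and $\operatorname{krank}(F^{\top})\ge 2$. Then the rank-$(R,S)$ PT2D of $\mathcal{T}$ is essentially unique. Also, $(R,S)$ are minimal ranks, i.e., $\mathcal{T}$ does not admit a rank-$(R',S')$ PT2D with either $R'<R$ or $S'<S$.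
   Context: All matrices and tensors are real. A tensor $\mathcal{T}\in\mathbb{R}^{I\times J\times K}$ admits a rank-$(R,S)$ ParaTuck-2 decomposition (PT2D), written $\mathcal{T}=\mathrm{PT2D}(A,B,F,G,H)$, with factors $A\in\mathbb{R}^{I\times R}$, $B\in\mathbb{R}^{J\times S}$, $F\in\mathbb{R}^{R\times S}$, $G\in\mathbb{R}^{R\times K}$, $H\in\mathbb{R}^{S\times K}$, if its frontal slices are $\mathcal{T}_{:,:,k}=A\,\mathrm{Diag}(g_k)\,F\,\mathrm{Diag}(h_k)\,B^{\top}$, $k=1,\ldots,K$, where $g_k,h_k$ are the $k$-th columns of $G,H$. $\odot$ is the Khatri–Rao (columnwise Kronecker) product. $\operatorname{krank}(Z)$ is the Kruskal rank: the largest $k$ such that every $k$ columns of $Z$ are linearly independent. The decomposition $\mathcal{T}=\mathrm{PT2D}(A,B,F,G,H)$ is called essentially unique if for every alternative rank-$(R,S)$ decomposition $\mathcal{T}=\mathrm{PT2D}(\widetilde A,\widetilde B,\widetilde F,\widetilde G,\widetilde H)$ there exist permutation matrices $\Pi_A\in\mathbb{R}^{R\times R}$, $\Pi_B\in\mathbb{R}^{S\times S}$ and nonsingular diagonal matrices $\Lambda_A,\Lambda_G\in\mathbb{R}^{R\times R}$, $\Lambda_B,\Lambda_H\in\mathbb{R}^{S\times S}$, $\Lambda_{GH}\in\mathbb{R}^{K\times K}$ such that $$\widetilde A=A\Pi_A\Lambda_A,\quad \widetilde B=B\Pi_B\Lambda_B,\quad \widetilde F=\Pi_A^{\top}\Lambda_G^{-1}F\Lambda_H^{-1}\Pi_B,$$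 $$\widetilde G=\Lambda_A^{-1}\Pi_A^{\top}\Lambda_G G\Lambda_{GH},\quad \widetilde H=\Lambda_B^{-1}\Pi_B^{\top}\Lambda_H H\Lambda_{GH}^{-1}.$$
   Formalization: Essential uniqueness is proved under the added assumption that no frontal slice of T is zero; with a zero slice it always fails, since g_k or h_k can then be changed freely. Minimality of (R,S) is proved without this assumption. *)

(* Defs.v *)
From HB Require Import structures.
From mathcomp Require Import all_boot all_order all_fingroup all_algebra.
From mathcomp Require Import mxtens.
From mathcomp Require Import reals.

Set Implicit Arguments.
Unset Strict Implicit.
Unset Printing Implicit Defensive.

Import Order.TTheory GRing.Theory Num.Theory.
Local Open Scope ring_scope.

Definition tensor (R : realType) (I J K : nat) : Type :=
  'I_I -> 'I_J -> 'I_K -> R.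

Definition frontal_slice (R : realType) (I J K : nat)
    (T : tensor R I J K) (k : 'I_K) : 'M[R]_(I, J) :=
  \matrix_(i, j) T i j k.

(* [diag_mx] takes a row vector, hence the transposed columns. *)
Definition is_PT2D (R : realType) (I J K r s : nat) (T : tensor R I J K)
    (A : 'M[R]_(I, r)) (B : 'M[R]_(J, s)) (F : 'M[R]_(r, s))
    (G : 'M[R]_(r, K)) (H : 'M[R]_(s, K)) : Prop :=
  forall k : 'I_K,
    frontal_slice T k =
      A *m diag_mx (col k G)^T *m F *m diag_mx (col k H)^T *m B^T.

Definition admits_PT2D (R : realType) (I J K : nat) (T : tensor R I J K)
    (r s : nat) : Prop :=
  exists (A : 'M[R]_(I, r)) (B : 'M[R]_(J, s)) (F : 'M[R]_(r, s))
         (G : 'M[R]_(r, K)) (H : 'M[R]_(s, K)), is_PT2D T A B F G H.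

(* [tensmx] is the Kronecker product; that of two columns has [1 * 1] columns,
   of which the index [0] selects the only one. *)
Definition khatri_rao (R : realType) (m p n : nat)
    (X : 'M[R]_(m, n)) (Y : 'M[R]_(p, n)) : 'M[R]_(m * p, n) :=
  \matrix_(i, k) tensmx (col k X) (col k Y) i 0.

Notation "X ⊙ Y" := (khatri_rao X Y) (at level 40, left associativity).

(* The bound [k <= n] on the number of columns chosen matters: for [k > n] the
   condition would hold vacuously. *)
Definition krank (R : realType) (m n : nat) (Z : 'M[R]_(m, n)) : nat :=
  \max_(k < n.+1 |
      [forall X : {set 'I_n},
         (#|X| == k) ==> free [seq col j Z | j <- enum X]]) k.

Definition nonsingular_diag (R : realType) (n : nat) (D : 'M[R]_n) : Prop :=
  is_diag_mx D /\ D \in unitmx.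

(* Uniqueness in this sense always fails for a tensor with a zero frontal slice
   [k] (as soon as [r, s > 0]): the slice is also produced by any [g_k] together
   with [h_k = 0] and by any [h_k] together with [g_k = 0], whereas the relations
   below preserve whether [g_k] and [h_k] vanish. *)
Definition essentially_unique (R : realType) (I J K r s : nat)
    (T : tensor R I J K)
    (A : 'M[R]_(I, r)) (B : 'M[R]_(J, s)) (F : 'M[R]_(r, s))
    (G : 'M[R]_(r, K)) (H : 'M[R]_(s, K)) : Prop :=
  forall (A' : 'M[R]_(I, r)) (B' : 'M[R]_(J, s)) (F' : 'M[R]_(r, s))
         (G' : 'M[R]_(r, K)) (H' : 'M[R]_(s, K)),
    is_PT2D T A' B' F' G' H' ->
    exists (PA : 'M[R]_r) (PB : 'M[R]_s) (LA LG : 'M[R]_r) (LB LH : 'M[R]_s)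
           (LGH : 'M[R]_K),
      (is_perm_mx PA /\ is_perm_mx PB) /\
      [/\ nonsingular_diag LA, nonsingular_diag LG, nonsingular_diag LB,
          nonsingular_diag LH & nonsingular_diag LGH] /\
      [/\ A' = A *m PA *m LA,
          B' = B *m PB *m LB,
          F' = PA^T *m invmx LG *m F *m invmx LH *m PB,
          G' = invmx LA *m PA^T *m LG *m G *m LGH
        & H' = invmx LB *m PB^T *m LH *m H *m invmx LGH].

(* Main.v *)
Require Import Defs.
From mathcomp Require Import all_boot all_order all_fingroup all_algebra.
From mathcomp Require Import mxtens reals ring.

(** Write [M(x, y) = Diag(x) F Diag(y)] ([scaled F x y]), so that the slices are
    [A M(g_k, h_k) B^T].  The proof rests on one consequence of the rank
    hypothesis: since the columns [g_k (x) g_k (x) h_k (x) h_k] fill the whole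
    space of tensors that are symmetric in the two [g]-slots and in the two
    [h]-slots, a form quadratic in [x] and quadratic in [y] that vanishes at
    every [(g_k, h_k)] vanishes identically ([separates_khatri_rao4]).  Squaring
    a bilinear form, the same holds for bilinear forms ([separates_11]).

    Minimality.  As [F] has no zero entry, [separates_11] says that the matrices
    [M(g_k, h_k)] span all [r x s] matrices, hence the slices jointly span the
    column space of [A].  Any other decomposition therefore has
    [A = A' U] and [B = B' V] ([PT2D_factor]), which bounds the ranks below, and
    for equal ranks makes [U] and [V] invertible.

    Uniqueness.  After cancelling [A'] and [B'], [U M(g_k, h_k) V^T] equals
    [Diag(g'_k) F' Diag(h'_k)], which is [F'] multiplied entrywise by a matrix of
    rank one.  The equations saying so involve products of two entries of
    [N(x, y) = U M(x, y) V^T], that is, quadratic forms in [x] and in [y], so they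
    hold for all [x] and [y].  If a column [a] of [U] had two nonzero entries, in
    rows [i] and [i'], then a choice of [x = e_a] and [y] would first show that
    rows [i] and [i'] of [F'] are proportional, then the equations give the
    same for rows [i] and [i'] of [N(x, y)] for all [x] and [y], and, because the
    rows of [F] are pairwise non-proportional, for rows [i] and [i'] of [U],
    which is absurd ([column_support]).  So [U] and [V] are monomial matrices.
    Once the permutations are undone, two scalings [F g h = F' g' h'] have to be
    compared: the entrywise ratio of [F] to [F'] has rank one, again because the
    [2 x 2] minors of that ratio are coefficients of a form vanishing at
    every [(g_k, h_k)] ([scaled_unique]). *)

Set Implicit Arguments.
Unset Strict Implicit.
Unset Printing Implicit Defensive.

Import Order.TTheory GRing.Theory Num.Theory.
Local Open Scope ring_scope.

(** * The Khatri-Rao matrix and its symmetries *)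

Lemma sum_mxtens_index (R : nmodType) m n (E : 'I_(m * n) -> R) :
  \sum_q E q = \sum_i \sum_j E (mxtens_index (i, j)).
Proof.
rewrite pair_bigA /= (reindex (@mxtens_index m n)) /=; first by apply: eq_bigr => -[].
by exists (@mxtens_unindex m n) => q _; rewrite ?mxtens_indexK ?mxtens_unindexK.
Qed.

(** Row indices of [X ⊙ X ⊙ Y ⊙ Y] read as quadruples, grouped by the slots that
    are symmetric. *)
Definition tens4 r s (t : ('I_r * 'I_r) * ('I_s * 'I_s)) : 'I_(r * r * s * s) :=
  mxtens_index (mxtens_index (mxtens_index t.1, t.2.1), t.2.2).

Definition untens4 r s (q : 'I_(r * r * s * s)) : ('I_r * 'I_r) * ('I_s * 'I_s) :=
  let (u, b') := mxtens_unindex q in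
  let (v, b) := mxtens_unindex u in
  (mxtens_unindex v, (b, b')).

Lemma tens4K r s : cancel (@tens4 r s) (@untens4 r s).
Proof. by move=> [p [b b']]; rewrite /untens4 /tens4 !mxtens_indexK. Qed.

Lemma untens4K r s : cancel (@untens4 r s) (@tens4 r s).
Proof.
move=> q; rewrite /untens4 -[RHS]mxtens_unindexK; case: mxtens_unindex => u b'.
rewrite -[u in RHS]mxtens_unindexK; case: mxtens_unindex => v b.
by rewrite /tens4 mxtens_unindexK.
Qed.

Lemma sum_tens4 (R : nmodType) r s (E : 'I_(r * r * s * s) -> R) :
  \sum_q E q = \sum_a \sum_a' \sum_b \sum_b' E (tens4 ((a, a'), (b, b'))).
Proof. by rewrite 3!sum_mxtens_index. Qed.

Lemma khatri_raoE (R : realType) m p n (X : 'M[R]_(m, n)) (Y : 'M[R]_(p, n)) i j k :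
  (X ⊙ Y) (mxtens_index (i, j)) k = X i k * Y j k.
Proof. by rewrite !mxE mxtens_indexK. Qed.

Lemma khatri_rao4E (R : realType) r s n (X : 'M[R]_(r, n)) (Y : 'M[R]_(s, n)) t k :
  (X ⊙ X ⊙ Y ⊙ Y) (tens4 t) k =
  X t.1.1 k * X t.1.2 k * Y t.2.1 k * Y t.2.2 k.
Proof. by case: t => [[a a'] [b b']]; rewrite /tens4 !khatri_raoE. Qed.

Lemma khatri_rao_row_mx (R : realType) m p n1 n2
    (X1 : 'M[R]_(m, n1)) (X2 : 'M[R]_(m, n2))
    (Y1 : 'M[R]_(p, n1)) (Y2 : 'M[R]_(p, n2)) :
  row_mx X1 X2 ⊙ row_mx Y1 Y2 = row_mx (X1 ⊙ Y1) (X2 ⊙ Y2).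
Proof.
apply/matrixP => q k; case: (mxtens_indexP q) => i j; rewrite khatri_raoE !mxE.
by case: splitP => k' _; rewrite khatri_raoE.
Qed.

(** [f] sends each row to an equal row lying in [S], so that the rows in [S] span. *)
Lemma rank_le_card (R : fieldType) m n (X : 'M[R]_(m, n)) (S : {set 'I_m})
    (f : 'I_m -> 'I_m) :
  (forall i, f i \in S) -> (forall i, row (f i) X = row i X) ->
  (\rank X <= #|S|)%N.
Proof.
move=> fS fX.
suff sub : (X <= rowsub (@enum_val _ (mem S)) X)%MS.
  exact: leq_trans (mxrankS sub) (rank_leq_row _).
apply/row_subP => i; rewrite -fX -(enum_rankK_in (fS i) (fS i)).
set t := enum_rank_in _ _.
suff -> : row (enum_val t) X = row t (rowsub (@enum_val _ (mem S)) X).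
  exact: row_sub.
by apply/rowP => j; rewrite !mxE.
Qed.

(** This is the dimension of the symmetric square of an [r]-dimensional space. *)
Lemma card_sorted_pairs r :
  #|[set p : 'I_r * 'I_r | (p.1 <= p.2)%N]| = (r * r.+1 %/ 2)%N.
Proof.
rewrite -sum1dep_card.
rewrite -(pair_big_dep xpredT (fun i j : 'I_r => (i <= j)%N) (fun _ _ => 1%N)) /=.
rewrite (exchange_big_dep xpredT) //=.
rewrite (eq_bigr (fun j : 'I_r => j.+1)); last first.
  move=> j _; rewrite sum1dep_card -[RHS]card_ord.
  have winj : injective (widen_ord (ltn_ord j)).
    by move=> i i' [] eq_ii'; apply: val_inj.
  rewrite -(card_imset _ winj).
  apply: eq_card => i; rewrite !inE; apply/idP/imsetP => [ij|[i' _ ->]].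
    by exists (Ordinal (ij : (i < j.+1)%N)) => //; apply: val_inj.
  by have := ltn_ord i'; rewrite ltnS.
have -> : (\sum_(j < r) j.+1 = \sum_(0 <= i < r.+1) i)%N.
  by rewrite big_nat_recl //= add0n big_mkord.
by rewrite bin2_sum bin2 /= mulnC divn2.
Qed.

(** Row [(a, a', b, b')] is unchanged when [a] and [a'], or [b] and [b'], are
    exchanged; the rows with [a <= a'] and [b <= b'] thus already span.  The rank
    in the hypothesis of the theorem is therefore the largest possible one. *)
Lemma rank_khatri_rao4 (R : realType) r s n (X : 'M[R]_(r, n)) (Y : 'M[R]_(s, n)) :
  (\rank (X ⊙ X ⊙ Y ⊙ Y) <= r * r.+1 %/ 2 * (s * s.+1 %/ 2))%N.
Proof.
pose sorted n := [set p : 'I_n * 'I_n | (p.1 <= p.2)%N].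
pose sort n (p : 'I_n * 'I_n) := if (p.1 <= p.2)%N then p else (p.2, p.1).
have sortP m p : sort m p \in sorted m.
  by rewrite /sort inE; case: ifP => //= /negbT; rewrite -ltnNge => /ltnW.
pose S := [set tens4 t | t in setX (sorted r) (sorted s)].
pose f q := tens4 (sort r (untens4 q).1, sort s (untens4 q).2).
rewrite -!card_sorted_pairs -cardsX -(card_imset _ (can_inj (@tens4K r s))).
apply: (rank_le_card (f := f)) => q.
  by apply: imset_f; rewrite in_setX !sortP.
rewrite -(untens4K q); case: (untens4 q) => [[a a'] [b b']].
apply/rowP => k; rewrite ![row _ _ _ _]mxE /f tens4K !khatri_rao4E /sort /=.
by case: ifP; case: ifP => _ _ /=; ring.
Qed.

(** * Forms determined by their values at the columns *)

Definition bilform (R : fieldType) r s (P : 'M[R]_(r, s)) (x : 'cV_r) (y : 'cV_s) : R :=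
  \sum_a \sum_b P a b * (x a 0 * y b 0).

(** A form of bidegree (2, 2) is determined by its values at the columns.  Equations
    between two products of bilinear forms express both the squares of bilinear
    forms and the [2 x 2] minors of a matrix of such forms. *)
Definition separates_22 (R : fieldType) r s n (G : 'M[R]_(r, n)) (H : 'M[R]_(s, n)) :=
  forall P1 P2 P3 P4 : 'M[R]_(r, s),
  (forall k, bilform P1 (col k G) (col k H) * bilform P2 (col k G) (col k H) =
             bilform P3 (col k G) (col k H) * bilform P4 (col k G) (col k H)) ->
  forall x y, bilform P1 x y * bilform P2 x y = bilform P3 x y * bilform P4 x y.

Lemma bilformZ (R : fieldType) r s c (P : 'M[R]_(r, s)) x y :
  bilform (c *: P) x y = c * bilform P x y.
Proof.
rewrite /bilform big_distrr /=; apply: eq_bigr => a _; rewrite big_distrr /=.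
by apply: eq_bigr => b _; rewrite mxE !mulrA.
Qed.

(** A product of two bilinear forms is a linear form in
    [x (x) x (x) y (x) y], with coefficient vector [w]. *)
Lemma mul_tens4_khatri_rao4 (R : realType) r s n (X : 'M[R]_(r, n)) (Y : 'M[R]_(s, n))
    (P Q : 'M[R]_(r, s)) (w : 'rV_(r * r * s * s)) k :
  (forall t, w 0 (tens4 t) = P t.1.1 t.2.1 * Q t.1.2 t.2.2) ->
  (w *m (X ⊙ X ⊙ Y ⊙ Y)) 0 k =
  bilform P (col k X) (col k Y) * bilform Q (col k X) (col k Y).
Proof.
move=> wE; rewrite mxE sum_tens4 /bilform big_distrl /=; apply: eq_bigr => a _.
rewrite big_distrr /=; apply: eq_bigr => a' _.
rewrite big_distrl /=; apply: eq_bigr => b _.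
rewrite big_distrr /=; apply: eq_bigr => b' _.
by rewrite wE khatri_rao4E !mxE /=; ring.
Qed.

(** Appending the column of an arbitrary point [(x, y)] to a Khatri-Rao matrix of
    maximal rank cannot increase the rank.  That column thus lies in the span of
    the others, and a linear form that vanishes on them vanishes on it. *)
Lemma separates_khatri_rao4 (R : realType) r s n (G : 'M[R]_(r, n)) (H : 'M[R]_(s, n)) :
  \rank (G ⊙ G ⊙ H ⊙ H) = (r * r.+1 %/ 2 * (s * s.+1 %/ 2))%N ->
  separates_22 G H.
Proof.
move=> rkGH P1 P2 P3 P4 eqGH x y.
pose w (P Q : 'M[R]_(r, s)) : 'rV_(r * r * s * s) :=
  \row_q let t := untens4 q in P t.1.1 t.2.1 * Q t.1.2 t.2.2.
have wE P Q t : w P Q 0 (tens4 t) = P t.1.1 t.2.1 * Q t.1.2 t.2.2.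
  by rewrite mxE tens4K.
pose V := x ⊙ x ⊙ y ⊙ y.
pose M := G ⊙ G ⊙ H ⊙ H.
have : (V^T <= M^T)%MS.
  have Msub : (M^T <= (row_mx M V)^T)%MS by rewrite tr_row_mx -addsmxE addsmxSl.
  have Vsub : (V^T <= (row_mx M V)^T)%MS by rewrite tr_row_mx -addsmxE addsmxSr.
  apply: submx_trans Vsub _; rewrite -(mxrank_leqif_sup Msub) eqn_leq mxrankS //=.
  rewrite [X in (_ <= X)%N]mxrank_tr mxrank_tr rkGH /M /V -!khatri_rao_row_mx.
  exact: rank_khatri_rao4.
case/submxP => D /(congr1 trmx); rewrite trmx_mul !trmxK => VE.
have w0 : (w P1 P2 - w P3 P4) *m M = 0.
  apply/rowP => k; rewrite mulmxBl mxE [(- (w P3 P4 *m M)) 0 k]mxE [RHS]mxE.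
  rewrite (mul_tens4_khatri_rao4 _ _ _ (wE P1 P2)) (mul_tens4_khatri_rao4 _ _ _ (wE P3 P4)).
  by rewrite eqGH subrr.
have := congr1 (mulmx^~ D^T) w0; rewrite -mulmxA -VE mul0mx mulmxBl => /rowP /(_ 0).
rewrite mxE [(- (w P3 P4 *m V)) 0 0]mxE [X in _ = X]mxE.
rewrite (mul_tens4_khatri_rao4 _ _ _ (wE P1 P2)) (mul_tens4_khatri_rao4 _ _ _ (wE P3 P4)).
have colid m (z : 'cV[R]_m) : col 0 z = z by apply/colP => i; rewrite mxE.
by rewrite !colid => /eqP; rewrite subr_eq0 => /eqP.
Qed.

Lemma separates_22_tr (R : fieldType) r s n (G : 'M[R]_(r, n)) (H : 'M[R]_(s, n)) :
  separates_22 G H -> separates_22 H G.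
Proof.
have bilformT (P : 'M[R]_(s, r)) x y : bilform P y x = bilform P^T x y.
  rewrite /bilform exchange_big /=; apply: eq_bigr => a _; apply: eq_bigr => b _.
  by rewrite mxE [y _ _ * _]mulrC.
move=> sep P1 P2 P3 P4 eqGH x y; rewrite !bilformT; apply: sep => k.
by rewrite -!bilformT.
Qed.

Lemma bilform_delta (R : fieldType) r s (P : 'M[R]_(r, s)) a b :
  bilform P (delta_mx a 0) (delta_mx b 0) = P a b.
Proof.
rewrite /bilform (bigD1 a) //= (bigD1 b) //= !mxE !eqxx !mulr1 !big1 ?addr0 // => i /negPf ni.
  by apply: big1 => j _; rewrite !mxE ni mul0r mulr0.
by rewrite !mxE ni !mulr0.
Qed.

(** A bilinear form vanishing at all columns has a square of bidegree (2, 2) with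
    the same property. *)
Lemma separates_11 (R : fieldType) r s n (G : 'M[R]_(r, n)) (H : 'M[R]_(s, n))
    (P : 'M[R]_(r, s)) :
  separates_22 G H -> (forall k, bilform P (col k G) (col k H) = 0) -> P = 0.
Proof.
move=> sep P0; apply/matrixP => a b; rewrite [RHS]mxE -(bilform_delta P).
have bilform0 x y : bilform (0 : 'M[R]_(r, s)) x y = 0.
  by rewrite /bilform big1 // => i _; rewrite big1 // => j _; rewrite mxE mul0r.
have : bilform P (delta_mx a 0) (delta_mx b 0) * bilform P (delta_mx a 0) (delta_mx b 0) = 0.
  rewrite (sep P P 0 0) ?bilform0 ?mul0r // => k.
  by rewrite P0 bilform0.
by move/eqP; rewrite mulf_eq0 orbb => /eqP.
Qed.

(** * Proportional rows and Kruskal rank *)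

(** Proportionality through [2 x 2] minors is a polynomial condition, which
    covers zero rows and can be transferred from the columns to all points. *)
Definition proportional (R : fieldType) m n (X : 'M[R]_(m, n)) i i' :=
  forall j j', X i j * X i' j' = X i j' * X i' j.

(** The minors of a product are combinations of minors (Cauchy-Binet). *)
Lemma proportional_mulmx (R : fieldType) m n p (X : 'M[R]_(m, n)) (W : 'M_(n, p)) i i' :
  proportional X i i' -> proportional (X *m W) i i'.
Proof.
move=> pX j j'; rewrite !mxE !big_distrlr /= [RHS]exchange_big /=.
apply: eq_bigr => a _; apply: eq_bigr => b _.
by rewrite mulrACA pX; ring.
Qed.

Lemma proportional_mulmxK (R : fieldType) m n (X : 'M[R]_(m, n)) (V : 'M_n) i i' :
  V \in unitmx -> proportional (X *m V) i i' -> proportional X i i'.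
Proof. by move=> uV /(@proportional_mulmx _ _ _ _ _ (invmx V)); rewrite mulmxK. Qed.

Lemma proportional_unitmx (R : fieldType) n (U : 'M[R]_n) i i' :
  U \in unitmx -> proportional U i i' -> i = i'.
Proof.
move=> uU; rewrite -[U]mul1mx => /(proportional_mulmxK uU) /(_ i i').
rewrite !mxE !eqxx [i' == i]eq_sym; case: eqVneq => //= _ /eqP.
by rewrite mulr0 mulr1 oner_eq0.
Qed.

Lemma krank_ge2_gt1 (R : realType) m n (Z : 'M[R]_(m, n)) :
  (2 <= krank Z)%N -> (1 < n)%N.
Proof.
move/leq_trans; apply; rewrite /krank; apply/bigmax_leqP => k _.
by rewrite -ltnS.
Qed.

(** The Kruskal rank is attained at some [k >= 2], and any two columns can be
    completed to a choice of [k] of them. *)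
Lemma krank_ge2_proportional (R : realType) m n (Z : 'M[R]_(m, n)) j j' :
  (2 <= krank Z)%N -> j != j' -> ~ proportional Z^T j j'.
Proof.
move=> kZ jj'.
have [k k2 /forallP frk] : exists2 k : 'I_n.+1, (2 <= k)%N &
    [forall X : {set 'I_n}, (#|X| == k) ==> free [seq col j Z | j <- enum X]].
  apply/exists_inP; apply: contraTT kZ; rewrite -ltnNge ltnS => /exists_inPn nok.
  apply/bigmax_leqP => k Pk; rewrite leqNgt; apply/negP => k2.
  by have := nok k k2; rewrite Pk.
pose D := [set j; j'].
(* Pads the pair with the first [k - 2] other columns. *)
pose X := D :|: [set x in take (k - 2) (enum (~: D))].
have cD : #|D| = 2 by rewrite cards2 jj'.
have cX : #|X| = k.
  rewrite cardsU disjoint_setI0 ?cards0 ?subn0.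
    rewrite cD cardsE (card_uniqP (take_uniq _ (enum_uniq _))) size_take -cardE.
    have -> : #|~: D| = (n - 2)%N by rewrite cardsCs setCK card_ord cD.
    have /= := ltn_ord k; rewrite ltnS => kn.
    case: ltnP => h; first by rewrite subnKC.
    rewrite leq_subLR subnKC // in h.
    by rewrite subnKC ?(leq_trans k2) //; apply/eqP; rewrite eqn_leq kn h.
  rewrite disjoint_sym; apply/setDidPl/setP => x; rewrite in_setD !inE.
  case: (boolP (x \in take _ _)) => [/mem_take|_]; last by rewrite andbF.
  by rewrite mem_enum !inE => ->.
have {frk} := frk X; rewrite cX eqxx /=.
have jX : j \in enum X by rewrite mem_enum !inE eqxx.
have j'X : j' \in rem j (enum X).
  by rewrite mem_rem_uniq ?enum_uniq // !inE eq_sym jj' mem_enum !inE eqxx orbT.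
have pX : perm_eq (enum X) ([:: j; j'] ++ rem j' (rem j (enum X))).
  apply: perm_trans (perm_to_rem jX) _; rewrite /= perm_cons.
  exact: perm_to_rem.
rewrite (perm_free (perm_map _ pX)) map_cat => /catl_free /=.
rewrite free_cons seq1_free span_seq1 => /andP[colj colj'] pr.
have [i0 Zi0] : exists i, Z i j' != 0.
  apply/existsP; apply: contraNT colj' => /existsPn Z0.
  by apply/eqP/colP => i; rewrite !mxE; have := Z0 i; rewrite negbK => /eqP.
case/negP: colj; apply/vlineP; exists (Z i0 j / Z i0 j').
apply/colP => i; rewrite !mxE; have := pr i i0; rewrite !mxE => e.
by apply: (mulIf Zi0); rewrite e mulrAC divfK // mulrC.
Qed.

Lemma unitmx_row_nz (R : fieldType) n (U : 'M[R]_n) i :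
  U \in unitmx -> exists a, U i a != 0.
Proof.
move=> uU; apply/existsP; apply: contraT => /existsPn U0.
have := congr1 (fun M : 'M_n => M i i) (mulmxV uU).
rewrite !mxE eqxx big1 => [/esym/eqP|j _]; first by rewrite oner_eq0.
by have := U0 j; rewrite negbK => /eqP ->; rewrite mul0r.
Qed.

(** * Congruences preserving rank-one patterns are monomial *)

Definition scaled (R : fieldType) r s (F : 'M[R]_(r, s)) (x : 'cV_r) (y : 'cV_s) :=
  diag_mx x^T *m F *m diag_mx y^T.

Lemma scaledE (R : fieldType) r s (F : 'M[R]_(r, s)) x y a b :
  scaled F x y a b = x a 0 * F a b * y b 0.
Proof. by rewrite /scaled mul_mx_diag mul_diag_mx !mxE. Qed.

Lemma scaled_tr (R : fieldType) r s (F : 'M[R]_(r, s)) x y :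
  (scaled F x y)^T = scaled F^T y x.
Proof. by rewrite /scaled !trmx_mul !tr_diag_mx mulmxA. Qed.

Lemma congruence_bilform (R : fieldType) r s p q (U : 'M[R]_(p, r)) (V : 'M_(q, s))
    (F : 'M_(r, s)) x y i j :
  (U *m scaled F x y *m V^T) i j =
  bilform (\matrix_(a, b) (U i a * F a b * V j b)) x y.
Proof.
rewrite mxE /bilform exchange_big /=; apply: eq_bigr => b _.
rewrite mxE big_distrl /=; apply: eq_bigr => a _.
by rewrite scaledE !mxE; ring.
Qed.

(** With [x = e_a] only row [a] of [F] survives, and [F] having no zero there lets
    [y] turn it into any row; the one that [V^T] maps to the all-ones row copies
    column [a] of [U] into every column of the result. *)
Lemma probe_column (R : fieldType) r s q (F : 'M[R]_(r, s)) (V : 'M_s) a :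
  (forall b, F a b != 0) -> V \in unitmx ->
  exists y, forall (U : 'M_(q, r)) i j,
    (U *m scaled F (delta_mx a 0) y *m V^T) i j = U i a.
Proof.
move=> Fnz uV; pose z : 'cV_s := invmx V *m const_mx 1.
exists (\col_b (z b 0 / F a b)) => U i j.
have -> : scaled F (delta_mx a 0) (\col_b (z b 0 / F a b)) = delta_mx a 0 *m z^T.
  apply/matrixP => c b; rewrite scaledE [RHS]mxE big_ord1 !mxE eqxx andbT.
  case: eqVneq => [->|_]; last by rewrite !mul0r.
  by rewrite mulrCA mul1r mulfV ?mulr1 // mul1r.
rewrite mulmxA -colE -mulmxA -trmx_mul mulKVmx // mxE big_ord1 !mxE.
by rewrite mulr1.
Qed.

(** The equations on [N] say that [N(x, y)] divided entrywise by [F'] has rank at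
    most one.  If rows [i] and [i'] of [U] both meet column [a], evaluation at the
    point of [probe_column] forces rows [i] and [i'] of [F'] to be proportional;
    this passes to [N(x, y)] for all [x] and [y].  Taking [x = e_b + e_b'] and
    using that rows [b] and [b'] of [F] are independent, it passes to [U]. *)
Lemma column_support (R : fieldType) r s (F F' : 'M[R]_(r, s)) (U : 'M_r) (V : 'M_s) :
  (forall a b, F a b != 0) -> (forall i j, F' i j != 0) ->
  (forall a a', a != a' -> ~ proportional F a a') ->
  U \in unitmx -> V \in unitmx ->
  (forall x y i i' j j', let N := U *m scaled F x y *m V^T in
     F' i j' * F' i' j * (N i j * N i' j') = F' i j * F' i' j' * (N i j' * N i' j)) ->
  forall a i i', U i a != 0 -> U i' a != 0 -> i = i'.
Proof.
move=> Fnz F'nz Find uU uV minN a i i' Uia Ui'a.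
(* Here both sides of the equations are multiples of [U i a * U i' a]. *)
have pF' : proportional F' i i'.
  have [y yE] := probe_column r (Fnz a) uV => j j'.
  have := minN (delta_mx a 0) y i i' j j' => /=; rewrite !yE.
  by move/(mulIf (mulf_neq0 Uia Ui'a)) => ->.
have pN x y : proportional (U *m scaled F x y) i i'.
  have uVT : V^T \in unitmx by rewrite unitmx_tr.
  apply: (proportional_mulmxK uVT) => j j'.
  by apply: (mulfI (mulf_neq0 (F'nz i j) (F'nz i' j'))); rewrite -minN pF'.
apply: (proportional_unitmx uU) => b b'.
have [->//|bb'] := eqVneq b b'.
apply/eqP; rewrite -subr_eq0; apply/negPn/negP => nz.
apply: (Find _ _ bb') => c c'.
have WE l m : (U *m scaled F (delta_mx b 0 + delta_mx b' 0) (const_mx 1)) l m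
    = U l b * F b m + U l b' * F b' m.
  have -> : scaled F (delta_mx b 0 + delta_mx b' 0) (const_mx 1)
      = delta_mx b 0 *m row b F + delta_mx b' 0 *m row b' F.
    apply/matrixP => e f; rewrite scaledE ![(_ *m row _ _ + _) _ _]mxE.
    rewrite ![(_ *m row _ _) _ _]mxE !big_ord1 !mxE !eqxx !andbT mulr1 mulrDl.
    by congr (_ + _); case: eqVneq => [->|_]; rewrite ?mul0r.
  by rewrite mulmxDr !mulmxA -!colE !mxE !big_ord1 !mxE.
have := pN (delta_mx b 0 + delta_mx b' 0) (const_mx 1) c c'; rewrite !WE => e.
(* By [WE], the minor in [e] is that of [U] in columns [b, b'] times that of [F]. *)
apply: (mulfI nz); apply/eqP; rewrite -subr_eq0; apply/eqP.
move/eqP: e; rewrite -subr_eq0 => /eqP <-; ring.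
Qed.

(** At the columns, entry [(i, j)] of the congruent matrix is
    [F' i j * g' i * h' j], which yields the equations of [column_support] there;
    separation extends them to all points.  A zero of [F'] would likewise give a
    bilinear form vanishing everywhere, against [probe_column].  The statement
    on [V] is the one on [U] after transposition. *)
Lemma congruence_monomial (R : fieldType) r s n (F F' : 'M[R]_(r, s)) (G G' : 'M_(r, n))
    (H H' : 'M_(s, n)) (U : 'M_r) (V : 'M_s) :
  (forall a b, F a b != 0) ->
  (forall a a', a != a' -> ~ proportional F a a') ->
  (forall b b', b != b' -> ~ proportional F^T b b') ->
  separates_22 G H -> U \in unitmx -> V \in unitmx ->
  (forall k, U *m scaled F (col k G) (col k H) *m V^T = scaled F' (col k G') (col k H')) ->
  [/\ forall i j, F' i j != 0,
      forall a i i', U i a != 0 -> U i' a != 0 -> i = i' &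
      forall b j j', V j b != 0 -> V j' b != 0 -> j = j'].
Proof.
move=> Fnz rowF colF sep uU uV eqN.
pose C i j := \matrix_(a, b) (U i a * F a b * V j b).
have CE k i j : bilform (C i j) (col k G) (col k H) = F' i j * (G' i k * H' j k).
  by rewrite -congruence_bilform eqN scaledE !mxE; ring.
have F'nz i j : F' i j != 0.
  apply/negP => /eqP F'0; have [a /negP] := unitmx_row_nz i uU; apply.
  have C0 : C i j = 0 by apply: (separates_11 sep) => k; rewrite CE F'0 mul0r.
  have [y yE] := probe_column r (Fnz a) uV.
  rewrite -(yE U i j) congruence_bilform -/(C i j) C0 /bilform big1 // => c _.
  by rewrite big1 // => e _; rewrite mxE mul0r.
have minN x y i i' j j' : let N := U *m scaled F x y *m V^T in
    F' i j' * F' i' j * (N i j * N i' j') = F' i j * F' i' j' * (N i j' * N i' j).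
  rewrite /= !congruence_bilform.
  have := sep ((F' i j' * F' i' j) *: C i j) (C i' j')
    ((F' i j * F' i' j') *: C i j') (C i' j) _ x y.
  by rewrite !bilformZ -!mulrA; apply=> k; rewrite !bilformZ !CE; ring.
split=> //; first exact: (column_support Fnz F'nz rowF uU uV minN).
apply: (@column_support _ _ _ F^T F'^T V U) => //.
- by move=> b a; rewrite mxE.
- by move=> j i; rewrite mxE.
move=> y x j j' i i' /=.
have NT l m : (V *m scaled F^T y x *m U^T) m l = (U *m scaled F x y *m V^T) l m.
  by rewrite -scaled_tr -[V in LHS]trmxK -!trmx_mul mulmxA mxE.
rewrite !NT ![F'^T _ _]mxE; have /= := minN x y i i' j j'; rewrite [X in _ = _ * X]mulrC.
by rewrite [F' i j' * _]mulrC => ->.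
Qed.

Lemma monomial_perm (R : fieldType) n (U : 'M[R]_n) :
  U \in unitmx -> (forall a i i', U i a != 0 -> U i' a != 0 -> i = i') ->
  exists (p : 'S_n) (d : 'rV[R]_n),
    (forall i, d 0 i != 0) /\ U = diag_mx d *m (perm_mx p)^T.
Proof.
move=> uU supp.
have uUT : U^T \in unitmx by rewrite unitmx_tr.
have /fin_all_exists[f fP] a : exists i, U i a != 0.
  by have [i] := unitmx_row_nz a uUT; rewrite mxE; exists i.
have U0 i a : i != f a -> U i a = 0.
  by move=> ifa; apply/eqP; apply: contraNT ifa => Uia; apply/eqP; apply: supp Uia (fP a).
have finj : injective f.
  (* Columns supported on the same single row are proportional. *)
  move=> a a' faa'; apply: (proportional_unitmx uUT) => j j'; rewrite !mxE.
  have [->|ja] := eqVneq j (f a); last first.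
    by rewrite (U0 _ _ ja) mul0r [U j a']U0 -?faa' // mulr0.
  have [->//|j'a] := eqVneq j' (f a).
  by rewrite (U0 _ _ j'a) mul0r [U j' a']U0 -?faa' // mulr0.
exists (perm finj), (\row_i U i ((perm finj)^-1%g i)); split=> [i|].
  by rewrite mxE -{1}[i](permKV (perm finj)) permE.
apply/matrixP => i a; rewrite mul_diag_mx tr_perm_mx !mxE.
have [<-|ia] := eqVneq ((perm finj)^-1%g i) a; first by rewrite mulr1.
rewrite mulr0 U0 //; apply: contra ia => /eqP ->.
by rewrite -(permE finj) permK.
Qed.

Lemma diag_mx_nz (R : fieldType) n (d : 'rV[R]_n) : (forall i, d 0 i != 0) ->
  diag_mx d \in unitmx /\ invmx (diag_mx d) = diag_mx (\row_i (d 0 i)^-1).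
Proof.
move=> dnz.
have dV : diag_mx d *m diag_mx (\row_i (d 0 i)^-1) = 1%:M.
  apply/matrixP => i j; rewrite mul_diag_mx !mxE.
  by case: eqVneq => [->|_]; rewrite ?mulr0n ?mulr0 // !mulr1n mulfV.
have [ud _] := mulmx1_unit dV; split=> //.
by rewrite -[LHS]mulmx1 -dV mulKmx.
Qed.

(** * Comparing two scalings *)

(** Let [rho] be the entrywise ratio of [F] to [F'].  From
    [rho a b * g a * h b = g' a * h' b] at every column, a minor of [rho] times
    the monomial [g a * g a0 * h b * h b0] vanishes at every column, hence
    identically; so [rho] has rank one and splits into the two diagonal scalings.  What remains free is, for each
    [k], one scalar [e k] shared between [g'_k] and [h'_k]; it is determined and
    nonzero since slice [k] is nonzero. *)
Lemma scaled_unique (R : fieldType) r s n (F F' : 'M[R]_(r, s)) (G G' : 'M_(r, n))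
    (H H' : 'M_(s, n)) (a0 : 'I_r) (b0 : 'I_s) :
  (forall a b, F a b != 0) -> (forall a b, F' a b != 0) -> separates_22 G H ->
  (forall k, scaled F (col k G) (col k H) != 0) ->
  (forall k, scaled F (col k G) (col k H) = scaled F' (col k G') (col k H')) ->
  exists (c : 'rV_r) (d : 'rV_s) (e : 'rV_n),
    [/\ forall a, c 0 a != 0, forall b, d 0 b != 0 & forall k, e 0 k != 0] /\
    [/\ F = diag_mx c *m F' *m diag_mx d,
        G' = diag_mx c *m G *m diag_mx e &
        H' = diag_mx d *m H *m invmx (diag_mx e)].
Proof.
move=> Fnz F'nz sep slice0 eqM.
pose rho a b := F a b / F' a b.
have rho0 a b : rho a b != 0 by rewrite mulf_neq0 ?invr_eq0.
have eqk a b k : rho a b * (G a k * H b k) = G' a k * H' b k.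
  have := congr1 (fun M : 'M_(r, s) => M a b) (eqM k); rewrite !scaledE !mxE => e.
  apply: (mulIf (F'nz a b)); rewrite /rho mulrAC divfK //.
  by transitivity (G a k * F a b * H b k); [ring | rewrite e; ring].
have rho_prod a b : rho a b * rho a0 b0 = rho a b0 * rho a0 b.
  have bilformZdelta (x : 'cV_r) (y : 'cV_s) u v z :
      bilform (z *: delta_mx u v) x y = z * (x u 0 * y v 0).
    rewrite /bilform (bigD1 u) //= (bigD1 v) //= !mxE !eqxx mulr1.
    rewrite big1 => [|j /negPf nj]; last by rewrite !mxE nj andbF mulr0 mul0r.
    rewrite big1 ?addr0 // => i /negPf ni; rewrite big1 // => j _.
    by rewrite !mxE ni mulr0 mul0r.
  have := sep (rho a b *: delta_mx a b) (rho a0 b0 *: delta_mx a0 b0)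
    (rho a b0 *: delta_mx a b0) (rho a0 b *: delta_mx a0 b) _
    (const_mx 1) (const_mx 1).
  rewrite !bilformZdelta !mxE !mulr1; apply => k.
  by rewrite !bilformZdelta !mxE !eqk; ring.
have /fin_all_exists[e eP] k : exists e, [/\ e != 0,
    forall a, G' a k = rho a b0 * G a k * e &
    forall b, H' b k = rho a0 b / rho a0 b0 * H b k / e].
  have [a1 [b1 Mab]] : exists a b, G a k * H b k != 0.
    have : ~~ [forall a, forall b, scaled F (col k G) (col k H) a b == 0].
      apply: contra (slice0 k) => /forallP M0; apply/eqP/matrixP => a b.
      by have /forallP/(_ b)/eqP -> := M0 a; rewrite mxE.
    case/forallPn => a /forallPn[b]; rewrite scaledE !mxE => nz.
    by exists a, b; apply: contraNneq nz => nz; rewrite mulrAC nz mul0r.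
  have [Ga Hb] : G a1 k != 0 /\ H b1 k != 0 by apply/andP; rewrite -negb_or -mulf_eq0.
  have [G'a H'b] : G' a1 k != 0 /\ H' b1 k != 0.
    by apply/andP; rewrite -negb_or -mulf_eq0 -eqk mulf_neq0.
  (* The value that the second scaling relation imposes at the row [b1]. *)
  pose e := rho a0 b1 / rho a0 b0 * H b1 k / H' b1 k.
  have e0 : e != 0 by rewrite /e !mulf_neq0 ?invr_eq0.
  have rhoE a b : rho a b = rho a b0 * (rho a0 b / rho a0 b0).
    by apply: (mulIf (rho0 a0 b0)); rewrite rho_prod mulrA divfK.
  have G'E a : G' a k = rho a b0 * G a k * e.
    apply: (mulIf H'b); rewrite -eqk rhoE /e.
    by field; rewrite H'b rho0.
  exists e; split=> // b; apply: (mulfI G'a).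
  rewrite -eqk rhoE [in RHS]G'E; field.
  by rewrite rho0 e0.
exists (\row_a rho a b0), (\row_b (rho a0 b / rho a0 b0)), (\row_k e k).
have enz k : (\row_k e k) 0 k != 0 by rewrite mxE; case: (eP k).
split; first by split=> // i; rewrite mxE ?mulf_neq0 ?invr_eq0.
have [_ ->] := diag_mx_nz enz.
split; apply/matrixP => i j; rewrite mul_mx_diag mul_diag_mx !mxE.
- rewrite [LHS](_ : _ = rho i j * F' i j); last by rewrite divfK.
  apply: (mulIf (rho0 a0 b0)); rewrite mulrAC rho_prod.
  by field; rewrite rho0.
- by case: (eP j) => _ ->.
- by case: (eP j) => _ _ ->.
Qed.

(** Undoing the monomial matrices: their permutations act on [F'], and on [G'] and
    [H'] together with the diagonal parts. *)
Lemma scaled_perm (R : fieldType) r s n (F F' : 'M[R]_(r, s)) (G G' : 'M_(r, n))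
    (H H' : 'M_(s, n)) (p : 'S_r) (q : 'S_s) (d : 'rV_r) (e : 'rV_s) k :
  (forall i, d 0 i != 0) -> (forall j, e 0 j != 0) ->
  (diag_mx d *m (perm_mx p)^T) *m scaled F (col k G) (col k H) *m
    (diag_mx e *m (perm_mx q)^T)^T = scaled F' (col k G') (col k H') ->
  scaled F (col k G) (col k H) =
  scaled (perm_mx p *m F' *m (perm_mx q)^T)
    (col k (perm_mx p *m invmx (diag_mx d) *m G'))
    (col k (perm_mx q *m invmx (diag_mx e) *m H')).
Proof.
move=> dnz enz; set M := scaled F _ _ => eqM.
have [_ ->] := diag_mx_nz dnz; have [_ ->] := diag_mx_nz enz.
apply/matrixP => a b; rewrite scaledE -!mulmxA !mul_diag_mx.
rewrite tr_perm_mx -col_permE -!row_permE !mxE.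
have congrE (X : 'M_(r, s)) :
    (diag_mx d *m (perm_mx p)^T *m X *m (diag_mx e *m (perm_mx q)^T)^T) (p a) (q b)
    = d 0 (p a) * X a b * e 0 (q b).
  rewrite trmx_mul trmxK tr_diag_mx -!mulmxA mul_diag_mx mxE !mulmxA.
  rewrite mul_mx_diag mxE tr_perm_mx -row_permE -{1}[q]invgK -col_permE.
  by rewrite 2!mxE !permK mulrA.
have := congrE M.
rewrite eqM scaledE !mxE => eqM'.
apply: (mulfI (dnz (p a))); apply: (mulIf (enz (q b))); rewrite -eqM'.
by field; rewrite dnz enz.
Qed.

(** * The decomposition *)

Lemma PT2D_scaled (R : realType) I J K r s (T : tensor R I J K)
    (A : 'M[R]_(I, r)) (B : 'M_(J, s)) (F : 'M_(r, s)) (G : 'M_(r, K)) (H : 'M_(s, K)) :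
  is_PT2D T A B F G H ->
  forall k, frontal_slice T k = A *m scaled F (col k G) (col k H) *m B^T.
Proof. by move=> dec k; rewrite dec /scaled !mulmxA. Qed.

Lemma PT2D_tr (R : realType) I J K r s (T : tensor R I J K)
    (A : 'M[R]_(I, r)) (B : 'M_(J, s)) (F : 'M_(r, s)) (G : 'M_(r, K)) (H : 'M_(s, K)) :
  is_PT2D T A B F G H -> is_PT2D (fun j i k => T i j k) B A F^T H G.
Proof.
move=> dec k.
have -> : frontal_slice (fun j i k => T i j k) k = (frontal_slice T k)^T.
  by apply/matrixP => j i; rewrite !mxE.
by rewrite dec !trmx_mul !tr_diag_mx trmxK !mulmxA.
Qed.

(** Whatever annihilates the columns of [A'] on the left annihilates all slices,
    hence [w A (scaled F g_k h_k) = 0]; the entries of this are bilinear forms in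
    [(g_k, h_k)] with coefficients [(w A) i a * F a b], which must vanish.  So the
    left kernel of [A'] is contained in that of [A]. *)
Lemma PT2D_factor (R : realType) I J K r s r' s' (T : tensor R I J K)
    (A : 'M[R]_(I, r)) (B : 'M_(J, s)) (F : 'M_(r, s)) (G : 'M_(r, K)) (H : 'M_(s, K))
    (A' : 'M[R]_(I, r')) (B' : 'M_(J, s')) (F' : 'M_(r', s')) (G' : 'M_(r', K))
    (H' : 'M_(s', K)) :
  (0 < s)%N -> is_PT2D T A B F G H -> \rank B = s ->
  (forall a b, F a b != 0) -> separates_22 G H ->
  is_PT2D T A' B' F' G' H' -> exists U, A = A' *m U.
Proof.
move=> s_gt0 /PT2D_scaled dec rkB Fnz sep /PT2D_scaled dec'.
(* The rows of [w] span the left kernel of [A']. *)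
pose w := (cokermx A'^T)^T.
have wA' : w *m A' = 0 by apply: trmx_inj; rewrite trmx_mul trmxK mulmx_coker trmx0.
have wA : w *m A = 0.
  have wAM k : w *m A *m scaled F (col k G) (col k H) = 0.
    have freeB : row_free B^T by rewrite /row_free mxrank_tr rkB.
    apply: (row_free_inj freeB).
    rewrite mul0mx; transitivity (w *m frontal_slice T k).
      by rewrite dec !mulmxA.
    by rewrite dec' !mulmxA wA' !mul0mx.
  pose b := Ordinal s_gt0.
  apply/matrixP => i a; rewrite [RHS]mxE.
  have P0 : \matrix_(c, e) ((w *m A) i c * F c e * (1%:M : 'M_s) b e) = 0.
    apply: (separates_11 sep) => k.
    by rewrite -congruence_bilform trmx1 mulmx1 wAM mxE.
  have /eqP := congr1 (fun M : 'M_(r, s) => M a b) P0.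
  rewrite mxE [X in _ * X]mxE eqxx mulr1 [X in _ == X]mxE mulf_eq0.
  by rewrite (negPf (Fnz a b)) orbF => /eqP.
have : (A^T <= A'^T)%MS.
  by rewrite submxE -[_ *m _]trmxK trmx_mul trmxK -/w wA trmx0.
by case/submxP => D /(congr1 trmx); rewrite trmx_mul !trmxK => ->; exists D^T.
Qed.

Lemma PT2D_essentially_unique (R : realType) I J K r s (T : tensor R I J K)
    (A : 'M[R]_(I, r)) (B : 'M_(J, s)) (F : 'M_(r, s)) (G : 'M_(r, K)) (H : 'M_(s, K)) :
  (0 < r)%N -> (0 < s)%N -> is_PT2D T A B F G H -> \rank A = r -> \rank B = s ->
  (forall a b, F a b != 0) ->
  (forall a a', a != a' -> ~ proportional F a a') ->
  (forall b b', b != b' -> ~ proportional F^T b b') ->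
  separates_22 G H -> (forall k, frontal_slice T k != 0) ->
  essentially_unique T A B F G H.
Proof.
move=> r_gt0 s_gt0 dec rkA rkB Fnz rowF colF sep slice0 A' B' F' G' H' dec'.
have [U AE] := PT2D_factor s_gt0 dec rkB Fnz sep dec'.
have [|V BE] := PT2D_factor r_gt0 (PT2D_tr dec) rkA _ (separates_22_tr sep) (PT2D_tr dec').
  by move=> b a; rewrite mxE.
have full_unit n m (X Y : 'M[R]_(m, n)) (W : 'M_n) :
    X = Y *m W -> \rank X = n -> row_free Y^T /\ W \in unitmx.
  move=> -> rkYW; split.
    by rewrite /row_free mxrank_tr eqn_leq rank_leq_col -{1}rkYW mxrankM_maxl.
  by rewrite -row_free_unit /row_free eqn_leq rank_leq_col -{1}rkYW mxrankM_maxr.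
have [freeA' uU] := full_unit _ _ _ _ _ AE rkA.
have [freeB' uV] := full_unit _ _ _ _ _ BE rkB.
have eqN k : U *m scaled F (col k G) (col k H) *m V^T = scaled F' (col k G') (col k H').
  apply: (row_free_inj freeB'); apply: trmx_inj; apply: (row_free_inj freeA').
  apply: trmx_inj; rewrite !(trmx_mul _ A'^T) !trmxK.
  rewrite [RHS]mulmxA -(PT2D_scaled dec') (PT2D_scaled dec) AE BE trmx_mul.
  by rewrite !mulmxA.
have [F'nz supU supV] := congruence_monomial Fnz rowF colF sep uU uV eqN.
have [p [d [dnz UE]]] := monomial_perm uU supU.
have [q [e [enz VE]]] := monomial_perm uV supV.
have [ud _] := diag_mx_nz dnz; have [ue _] := diag_mx_nz enz.
have permK n (t : 'S_n) : (perm_mx t)^T *m perm_mx t = 1%:M :> 'M[R]_n.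
  by rewrite tr_perm_mx -perm_mxM mulVg perm_mx1.
set PA : 'M[R]_r := perm_mx p in UE *; set PB : 'M[R]_s := perm_mx q in VE *.
pose F1 := PA *m F' *m PB^T.
pose G1 := PA *m invmx (diag_mx d) *m G'.
pose H1 := PB *m invmx (diag_mx e) *m H'.
have F1nz a b : F1 a b != 0.
  by rewrite /F1 /PB tr_perm_mx -col_permE -row_permE !mxE F'nz.
have M0 k : scaled F (col k G) (col k H) != 0.
  apply: contraNneq (slice0 k) => M0.
  by rewrite (PT2D_scaled dec) M0 mulmx0 mul0mx.
have eqM k : scaled F (col k G) (col k H) = scaled F1 (col k G1) (col k H1).
  by apply: (scaled_perm dnz enz); rewrite -/PA -/PB -UE -VE.
have [c [c' [v [[cnz c'nz vnz] [FE GE HE]]]]] :=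
  scaled_unique (Ordinal r_gt0) (Ordinal s_gt0) Fnz F1nz sep M0 eqM.
have [uc _] := diag_mx_nz cnz; have [uc' _] := diag_mx_nz c'nz.
have [uv _] := diag_mx_nz vnz.
exists PA, PB, (invmx (diag_mx d)), (diag_mx c), (invmx (diag_mx e)), (diag_mx c'), (diag_mx v).
split; first by rewrite !perm_mx_is_perm.
split.
  split; split; rewrite ?unitmx_inv ?diag_mx_is_diag //.
    by have [_ ->] := diag_mx_nz dnz; rewrite diag_mx_is_diag.
  by have [_ ->] := diag_mx_nz enz; rewrite diag_mx_is_diag.
split.
- by rewrite AE UE -[RHS]mulmxA -!mulmxA [PA^T *m _]mulmxA permK mul1mx mulmxV ?mulmx1.
- by rewrite BE VE -[RHS]mulmxA -!mulmxA [PB^T *m _]mulmxA permK mul1mx mulmxV ?mulmx1.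
- rewrite FE -!mulmxA (mulKmx uc) [diag_mx c' *m _]mulmxA mulmxV // mul1mx.
  by rewrite permK mulmx1 mulmxA permK mul1mx.
- rewrite invmxK -!mulmxA (mulmxA (diag_mx c)) -GE /G1 -!mulmxA.
  by rewrite [PA^T *m _]mulmxA permK mul1mx mulKVmx.
rewrite invmxK -!mulmxA (mulmxA (diag_mx c')) -HE /H1 -!mulmxA.
by rewrite [PB^T *m _]mulmxA permK mul1mx mulKVmx.
Qed.

Theorem proposition5p5 (R : realType) (I J K r s : nat) (T : tensor R I J K)
    (A : 'M[R]_(I, r)) (B : 'M[R]_(J, s)) (F : 'M[R]_(r, s))
    (G : 'M[R]_(r, K)) (H : 'M[R]_(s, K)) :
  is_PT2D T A B F G H ->
  \rank A = r -> \rank B = s ->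
  (forall (i : 'I_r) (j : 'I_s), F i j != 0) ->
  \rank (G ⊙ G ⊙ H ⊙ H) = (r * r.+1 %/ 2 * (s * s.+1 %/ 2))%N ->
  (2 <= krank F)%N -> (2 <= krank F^T)%N ->
  ((forall k : 'I_K, frontal_slice T k != 0) ->
     essentially_unique T A B F G H) /\
  (forall r' s' : nat, (r' < r)%N \/ (s' < s)%N -> ~ admits_PT2D T r' s').
Proof.
move=> dec rkA rkB Fnz /separates_khatri_rao4 sep krF krFT.
have s_gt0 := ltnW (krank_ge2_gt1 krF); have r_gt0 := ltnW (krank_ge2_gt1 krFT).
split=> [slice0|r' s' lt_rs [A' [B' [F' [G' [H' dec']]]]]].
  apply: PT2D_essentially_unique => //.
    by move=> a a'; rewrite -[F in proportional F]trmxK; apply: krank_ge2_proportional.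
  by move=> b b'; apply: krank_ge2_proportional.
have [U AE] := PT2D_factor s_gt0 dec rkB Fnz sep dec'.
have [|V BE] := PT2D_factor r_gt0 (PT2D_tr dec) rkA _ (separates_22_tr sep) (PT2D_tr dec').
  by move=> b a; rewrite mxE.
have rank_ge n n' m (X : 'M[R]_(m, n)) (Y : 'M_(m, n')) W :
    X = Y *m W -> \rank X = n -> (n <= n')%N.
  by move=> XE <-; rewrite XE (leq_trans (mxrankM_maxl _ _)) ?rank_leq_col.
by case: lt_rs; rewrite ltnNge ?(rank_ge _ _ _ _ _ _ AE rkA) //
  (rank_ge _ _ _ _ _ _ BE rkB).
Qed.
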